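(* Let $b>a>0$, $q\ge1$, $0<s\le2$, $-1<(s-1)q\le1$, and $0\le\lambda\le1$. Then $$\begin{aligned} &\big|\lambda A(a^s,b^s)+(1-\lambda)A^s(a,b)-L_s^s(a,b)\big|\\ &\le\frac{(b-a)s}{2^{(s-1)/q+2}}\left[\frac1{s(s+1)}\right]^{1/q}\left(\tfrac12-\lambda+\lambda^2\right)^{1-1/q}\\ &\quad\times\Big\{\Big[\big(2(2-\lambda)^{s+1}+2^s((s+1)\lambda-2)+(s+1)\lambda-s-2\big)a^{(s-1)q}+\big(2\lambda^{s+1}+s-(s+1)\lambda\big)b^{(s-1)q}\Big]^{1/q}\\ &\qquad+\Big[\big(2\lambda^{s+1}+s-(s+1)\lambda\big)a^{(s-1)q}+\big(2(2-\lambda)^{s+1}+2^s((s+1)\lambda-2)+(s+1)\lambda-s-2\big)b^{(s-1)q}\Big]^{1/q}\Big\}. \end{aligned}$$ In particular, if $q=1$, then $$\big|\lambda A(a^s,b^s)+(1-\lambda)A^s(a,b)-L_s^s(a,b)\big|\le\frac{(b-a)s}{2^{s-1}s(s+1)}\Big\{(2-\lambda)^{s+1}+\lambda^{s+1}+[(s+1)\lambda-2]2^{s-1}-1\Big\}A(a^{s-1},b^{s-1}).$$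
   Context: For $a,b>0$, $A(a,b)=\frac{a+b}2$ is the arithmetic mean. The generalized logarithmic mean is, for $a\ne b$, $L_s(a,b)=\left[\frac{b^{s+1}-a^{s+1}}{(s+1)(b-a)}\right]^{1/s}$ if $s\ne0,-1$; $L_{-1}(a,b)=\frac{b-a}{\ln b-\ln a}$; $L_0(a,b)=\frac1e\left(\frac{b^b}{a^a}\right)^{1/(b-a)}$; and $L_s(a,a)=a$. Powers are written $A^r(a,b)=(A(a,b))^r$ and $L_s^s(a,b)=(L_s(a,b))^s$. *)

(* Defs.v *)
From HB Require Import structures.
From mathcomp Require Import all_boot all_order all_algebra.
From mathcomp Require Import reals sequences exp.

Set Implicit Arguments.
Unset Strict Implicit.
Unset Printing Implicit Defensive.

Import Order.TTheory GRing.Theory Num.Theory.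

Local Open Scope ring_scope.

(* Both means are intended for positive arguments. *)
Definition arith_mean (R : realType) (a b : R) : R := (a + b) / 2.

Definition gen_log_mean (R : realType) (s a b : R) : R :=
  if a == b then a
  else if s == 0 then
    (expR 1)^-1 * (b `^ b / a `^ a) `^ (1 / (b - a))
  else if s == -1 then
    (b - a) / (ln b - ln a)
  else
    ((b `^ (s + 1) - a `^ (s + 1)) / ((s + 1) * (b - a))) `^ (1 / s).

(* Main.v *)
(* Put c = 1 - lambda.  The half interval from the midpoint to an endpoint e is
   x(u) = ((1 + u) e + (1 - u) o) / 2 with o the other endpoint.  Integrating
   by parts, the left-hand side is (b - a) s / 4 times the difference of
   the integrals of (u - c) x(u)^(s-1) over [0, 1] on the two halves.
   With p = (s - 1) q, monotonicity (s <= 1) or subadditivity (s > 1) of x^p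
   gives x(u)^p <= y(u) := ((1 + u)/2)^(s-1) e^p + ((1 - u)/2)^(s-1) o^p.
   Holder's inequality for y^(1/q) is replaced by its linearisation: if W and C
   are the integrals of |u - c| and |u - c| y and M = C / W, Young's inequality
   bounds y^(1/q) by an affine function of y whose |u - c|-weighted integral is
   exactly M^(1/q) W = C^(1/q) W^(1-1/q).  All integrals now have elementary
   antiderivatives, whose increments are compared by the mean value theorem. *)
Require Import Defs.
From HB Require Import structures.
From mathcomp Require Import all_boot all_order all_algebra.
From mathcomp Require Import reals sequences exp.
From mathcomp Require Import functions set_interval classical_sets topology.
From mathcomp Require Import normedtype derive realfun.
From mathcomp Require Import ring lra.

Set Implicit Arguments.
Unset Strict Implicit.
Unset Printing Implicit Defensive.

Import Order.TTheory GRing.Theory Num.Theory.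
Import numFieldNormedType.Exports.

Local Open Scope classical_set_scope.
Local Open Scope ring_scope.

(** * Comparison of increments through derivatives *)

(** Both [G - F] and [G + F] have a nonnegative derivative, so the mean value theorem makes both
    increments nonnegative. *)
Lemma normB_le_of_deriv (R : realType) (F G f g : R -> R) (x y : R) :
  x <= y ->
  (forall u, u \in `]x, y[ -> is_derive u 1 F (f u)) ->
  (forall u, u \in `]x, y[ -> is_derive u 1 G (g u)) ->
  {within `[x, y], continuous F} ->
  {within `[x, y], continuous G} ->
  (forall u, u \in `]x, y[ -> `|f u| <= g u) ->
  `|F y - F x| <= G y - G x.
Proof.
rewrite le_eqVlt => /predU1P[->|xy]; first by rewrite !subrr normr0.
move=> dF dG cF cG fg.
have dB u : u \in `]x, y[ -> is_derive u 1 (G - F) (g u - f u).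
  by move=> uxy; apply: is_deriveB; [exact: dG|exact: dF].
have dD u : u \in `]x, y[ -> is_derive u 1 (G + F) (g u + f u).
  by move=> uxy; apply: is_deriveD; [exact: dG|exact: dF].
have [v vxy eB] := MVT xy dB (within_continuousB cG cF).
have [w wxy eD] := MVT xy dD (within_continuousD cG cF).
have := fg _ vxy; have := fg _ wxy; rewrite !ler_norml => /andP[w1 w2] /andP[v1 v2].
have hB : 0 <= (g v - f v) * (y - x) by apply: mulr_ge0; lra.
have hD : 0 <= (g w + f w) * (y - x) by apply: mulr_ge0; lra.
rewrite -eB in hB; rewrite -eD in hD.
move: hB hD; rewrite !fctE => hB hD.
by apply/andP; split; lra.
Qed.

(** * Real powers of affine functions *)

(** By convention the logarithm of a negative number is 0, so the plain power jumps at 0; the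
    absolute value removes the jump and makes the function continuous on the whole line. *)
Lemma continuous_powR_norm (R : realType) (r : R) : 0 < r ->
  continuous (fun z : R => `|z| `^ r).
Proof.
move=> r0 z; have [->|z0] := eqVneq z 0.
  apply/cvgrPdist_lt => e e0; rewrite normr0 powR0 ?gt_eqF//.
  near=> t; rewrite sub0r normrN ger0_norm ?powR_ge0//.
  have -> : e = (e `^ r^-1) `^ r by rewrite -powRrM mulVf ?gt_eqF// powRr1// ltW.
  apply: gt0_ltr_powR; rewrite ?nnegrE ?powR_ge0//.
  near: t; apply/nbhs_ballP; exists (e `^ r^-1) => /=; first exact: powR_gt0.
  by move=> t; rewrite /ball /= sub0r normrN.
have pz : 0 < `|z| by rewrite normr_gt0.
apply: (@continuous_comp _ _ _ (fun z : R => `|z|) (fun z => z `^ r)).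
  exact: norm_continuous.
apply/differentiable_continuous/derivable1_diffP.
exact: (@ex_derive _ _ _ _ _ _ _ (is_derive1_powR r pz)).
Unshelve. all: by end_near. Qed.

Lemma is_derive_powR_affine (R : realType) (k d r u : R) : 0 < k * u + d ->
  is_derive u 1 (fun x => (k * x + d) `^ r) (k * (r * (k * u + d) `^ (r - 1))).
Proof.
move=> h.
have dl : is_derive u 1 (fun x : R => k * x + d) k.
  by apply: is_derive_eq; rewrite /GRing.scale/= mulr1 addr0 ?mulr0 ?addr0.
rewrite mulrC.
exact: (@is_derive1_comp _ (fun z => z `^ r) _ u _ _ (is_derive1_powR r h) dl).
Qed.

Lemma continuous_within_powR_affine (R : realType) (k d r : R) :
  0 < r -> 0 <= d -> 0 <= k + d ->
  {within `[0, 1], continuous (fun x : R => (k * x + d) `^ r)}.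
Proof.
move=> r0 d0 kd0.
(* On [0, 1] the affine function is a convex combination of its end values [d] and [k + d], hence
   equals its absolute value. *)
apply: (@subspace_eq_continuous _ _ _ (fun x => `|k * x + d| `^ r)).
  move=> x; rewrite inE/= in_itv/= => /andP[x0 x1].
  rewrite ger0_norm//.
  have -> : k * x + d = (k + d) * x + d * (1 - x) by ring.
  by rewrite addr_ge0// mulr_ge0// subr_ge0.
apply: continuous_subspaceT => x.
apply: (@continuous_comp _ _ _ (fun x : R => k * x + d)
  (fun z => `|z| `^ r)); last exact: continuous_powR_norm.
by apply: cvgD; [apply: cvgM; [exact: cvg_cst|exact: cvg_id]|exact: cvg_cst].
Qed.

(** * Weighted moments and their increments *)

(* Antiderivative of (u - c) (k u + d)^(s-1). *)
Definition powR_moment (R : realType) (k d s c u : R) : R :=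
  (u - c) * (k * u + d) `^ s / (s * k)
  - (k * u + d) `^ (s + 1) / (s * (s + 1) * k ^+ 2).

Lemma is_derive_powR_moment (R : realType) (k d s c u : R) :
  k != 0 -> 0 < s -> 0 < k * u + d ->
  is_derive u 1 (powR_moment k d s c) ((u - c) * (k * u + d) `^ (s - 1)).
Proof.
move=> k0 s0 h; rewrite /powR_moment.
have := is_derive_powR_affine s h; have := is_derive_powR_affine (s + 1) h.
move=> d1 d2.
apply: is_derive_eq; rewrite /GRing.scale/= addrK.
field; rewrite k0 !gt_eqF//; lra.
Qed.

Lemma continuous_powR_moment (R : realType) (k d s c : R) :
  0 < s -> 0 <= d -> 0 <= k + d ->
  {within `[0, 1], continuous (powR_moment k d s c)}.
Proof.
move=> s0 d0 kd0.
have s10 : 0 < s + 1 by lra.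
have cid : {within `[0, 1], continuous (fun x : R => x)}.
  by apply: continuous_subspaceT => x; exact: cvg_id.
move=> x; apply: cvgB.
  apply: cvgM; last exact: cvg_cst.
  apply: cvgM; last exact: continuous_within_powR_affine.
  by apply: cvgB; [exact: cid|exact: cvg_cst].
by apply: cvgM; [exact: continuous_within_powR_affine|exact: cvg_cst].
Qed.

(* s (s + 1) times the integrals over [0, 1] of |u - (1 - l)| (1 + u)^(s-1),
   resp. |u - (1 - l)| (1 - u)^(s-1). *)
Definition far_coef (R : realType) (s l : R) : R :=
  2 * (2 - l) `^ (s + 1) + 2 `^ s * ((s + 1) * l - 2) + (s + 1) * l - s - 2.

Definition near_coef (R : realType) (s l : R) : R :=
  2 * l `^ (s + 1) + s - (s + 1) * l.

(** The weight [u - c] changes sign at [c], so [G] serves as majorant on [c, 1] and [- G] on [0, c];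
    the two increments add up to the integral of |u - c| g(u). *)
Lemma normB_le_of_deriv_split (R : realType) (F G f g : R -> R) (c : R) :
  0 <= c -> c <= 1 ->
  (forall u : R, u \in `]0, 1[ -> is_derive u 1 F ((u - c) * f u)) ->
  {within `[0, 1], continuous F} ->
  (forall u : R, u \in `]0, 1[ -> is_derive u 1 G ((u - c) * g u)) ->
  {within `[0, 1], continuous G} ->
  (forall u : R, u \in `]0, 1[ -> `|f u| <= g u) ->
  `|F 1 - F 0| <= G 1 - 2 * G c + G 0.
Proof.
move=> c0 c1 dF cF dG cG Ff.
have sub1 : `[c, 1] `<=` `[0, 1] by apply: subset_itv; rewrite bnd_simp.
have sub0 : `[0, c] `<=` `[0, 1] by apply: subset_itv; rewrite bnd_simp.
have in1 u : u \in `]c, 1[ -> u \in `]0, 1[.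
  by rewrite !in_itv/= => /andP[u0 ->]; rewrite (le_lt_trans c0).
have in0 u : u \in `]0, c[ -> u \in `]0, 1[.
  by rewrite !in_itv/= => /andP[-> u1]; rewrite (lt_le_trans u1).
have B1 : `|F 1 - F c| <= G 1 - G c.
  refine (normB_le_of_deriv c1 (fun u h => dF u (in1 u h))
    (fun u h => dG u (in1 u h)) (continuous_subspaceW sub1 cF)
    (continuous_subspaceW sub1 cG) _) => u cu1.
  have := cu1; rewrite in_itv/= => /andP[cu _].
  rewrite /= normrM gtr0_norm ?subr_gt0//.
    by apply: ler_wpM2l; [rewrite subr_ge0 ltW|exact/Ff/in1].
have cNG : {within `[0, c], continuous (- G)}.
  by move=> u; apply: cvgN; exact: (continuous_subspaceW sub0 cG).
have B0 : `|F c - F 0| <= - G c - - G 0.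
  refine (normB_le_of_deriv c0 (fun u h => dF u (in0 u h))
    (fun u h => is_deriveN (dG u (in0 u h))) (continuous_subspaceW sub0 cF)
    cNG _) => u cu0.
  have := cu0; rewrite in_itv/= => /andP[_ cu].
  rewrite /= normrM -mulNr ltr0_norm ?subr_lt0//.
  by apply: ler_wpM2l; [rewrite oppr_ge0 subr_le0 ltW|exact/Ff/in0].
have -> : F 1 - F 0 = (F 1 - F c) + (F c - F 0) by ring.
apply: (le_trans (ler_normD _ _)); apply: (le_trans (lerD B1 B0)); lra.
Qed.

Lemma norm_increment_le (R : realType) (s l al E O : R) (F f : R -> R) :
  0 < s -> 0 <= l -> l <= 1 ->
  (forall u : R, u \in `]0, 1[ -> is_derive u 1 F ((u - (1 - l)) * f u)) ->
  {within `[0, 1], continuous F} ->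
  (forall u : R, u \in `]0, 1[ ->
    `|f u| <= al + E * (1 + u) `^ (s - 1) + O * (1 - u) `^ (s - 1)) ->
  `|F 1 - F 0| <= al * (1 / 2 - l + l ^+ 2)
    + (far_coef s l * E + near_coef s l * O) / (s * (s + 1)).
Proof.
move=> s0 l0 l1 dF cF Ff; set c : R := 1 - l.
have s10 : 0 < s + 1 by lra.
have c01 : 0 <= c <= 1 by rewrite /c; lra.
have /andP[c0 c1] := c01.
(* [G] is an explicit antiderivative of (u - c) times the majorant of |f|; the right-hand side is
   the value of G(1) - 2 G(c) + G(0). *)
pose G := fun u : R => al * ((u - c) ^+ 2 / 2) + E * powR_moment 1 1 s c u
  + O * powR_moment (-1) 1 s c u.
pose g := fun u : R =>
  (al + E * (1 + u) `^ (s - 1) + O * (1 - u) `^ (s - 1)).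
have dG (u : R) : u \in `]0, 1[ -> is_derive u 1 G ((u - c) * g u).
  rewrite in_itv/= => /andP[u0 u1].
  have h1 : 0 < 1 * u + 1 :> R by lra.
  have h2 : 0 < -1 * u + 1 :> R by lra.
  have d1 := is_derive_powR_moment c (oner_neq0 _) s0 h1.
  have n1 : -1 != 0 :> R by rewrite oppr_eq0 oner_eq0.
  have d2 := is_derive_powR_moment c n1 s0 h2.
  apply: is_derive_eq; rewrite /GRing.scale/= /g.
  have -> : 1 * u + 1 = 1 + u by ring.
  have -> : -1 * u + 1 = 1 - u by ring.
  by field.
have cq : {within `[0, 1], continuous (fun u : R => al * ((u - c) ^+ 2 / 2))}.
  apply: continuous_subspaceT => u.
  apply: cvgM; first exact: cvg_cst.
  apply: cvgM; last exact: cvg_cst.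
  by apply: cvgM; (apply: cvgB; [exact: cvg_id|exact: cvg_cst]).
have cG : {within `[0, 1], continuous G}.
  move=> u; apply: cvgD; first apply: cvgD.
  - exact: cq.
  - by apply: cvgM; [exact: cvg_cst|apply: continuous_powR_moment => //; lra].
  - by apply: cvgM; [exact: cvg_cst|apply: continuous_powR_moment => //; lra].
apply: (le_trans (normB_le_of_deriv_split c0 c1 dF cF dG cG Ff)).
rewrite le_eqVlt; apply/orP; left; apply/eqP.
rewrite /G /powR_moment /far_coef /near_coef.
have -> : 1 * 1 + 1 = 2 :> R by ring.
have -> : -1 * 1 + 1 = 0 :> R by ring.
have -> : 1 * c + 1 = 2 - l by rewrite /c; ring.
have -> : -1 * c + 1 = l by rewrite /c; ring.
(* The base 1 - u vanishes at u = 1; its powers [s] and [s + 1] are 0 there because s > 0. *)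
rewrite !mulr0 !add0r !powR1 !powR0 ?gt_eqF//.
rewrite (@powRD _ 2 s 1) ?pnatr_eq0 ?implybT// powRr1//.
rewrite /c; field; rewrite !gt_eqF//.
Qed.

(** * Pointwise inequalities for powers *)

(* Tangent line at M of the concave function z^(1/q). *)
Lemma powR_young (R : realType) (q z M : R) : 1 <= q -> 0 <= z -> 0 < M ->
  z `^ (1 / q) <= (1 - 1 / q) * M `^ (1 / q) + M `^ (1 / q) / M / q * z.
Proof.
move=> q1 z0 M0; have q0 : 0 < q by lra.
have Mq := powR_gt0 (1 / q) M0.
(* Homogeneity reduces the claim to tangency at 1, with x = z / M. *)
suff H x : 0 <= x -> x `^ (1 / q) <= x / q + (1 - 1 / q).
  have -> : z = M * (z / M) by field; rewrite gt_eqF.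
  rewrite powRM ?divr_ge0 ?(ltW M0)//.
  have := ler_wpM2l (ltW Mq) (H (z / M) (divr_ge0 z0 (ltW M0))).
  move=> h; apply: (le_trans h); rewrite le_eqVlt; apply/orP; left; apply/eqP.
  by field; rewrite !gt_eqF.
move=> x0; move: q1; rewrite le_eqVlt => /predU1P[<-|q1].
  by rewrite !divr1 powRr1// subrr addr0.
(* Young's inequality for the factors x^(1/q) and 1 with the conjugate exponents q and q / (q - 1);
   q = 1 was treated apart. *)
have h1 : 0 < q / (q - 1) by apply: divr_gt0; lra.
have h2 : q^-1 + (q / (q - 1))^-1 = 1.
  by field; rewrite !gt_eqF//; lra.
have := conjugate_powR (powR_ge0 x (1 / q)) ler01 q0 h1 h2.
rewrite -powRrM powR1 mulr1 mul1r mulVf ?gt_eqF// powRr1// => h; apply: (le_trans h).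
rewrite le_eqVlt; apply/orP; left; apply/eqP.
by field; rewrite !gt_eqF//; lra.
Qed.

Lemma le0_ger_powR (R : realType) (p x y : R) : p <= 0 -> 0 < x -> x <= y ->
  y `^ p <= x `^ p.
Proof.
move=> p0 x0 xy; have y0 := lt_le_trans x0 xy.
rewrite -[p]opprK !(powRN _ (- p)) lef_pV2 ?posrE ?powR_gt0//.
by apply: ge0_ler_powR; rewrite ?nnegrE ?oppr_ge0 ?(ltW x0) ?(ltW y0).
Qed.

Lemma powR_convex_comb_le (R : realType) (t e o p r : R) :
  0 < t -> t < 1 -> 0 < e -> 0 < o ->
  (r <= 0 /\ p <= 0) \/ (r <= p /\ 0 <= p <= 1) ->
  (t * e + (1 - t) * o) `^ p <= t `^ r * e `^ p + (1 - t) `^ r * o `^ p.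
Proof.
move=> t0 t1 e0 o0.
have ep := powR_gt0 p e0; have op := powR_gt0 p o0.
have t'0 : 0 < 1 - t by lra.
have te0 : 0 < t * e by exact: mulr_gt0.
have to0 : 0 < (1 - t) * o by exact: mulr_gt0.
case=> [[r0 p0]|[rp /andP[p0 p1]]].
  (* Nonpositive exponents: the combination is at least min(e, o), so its power is at most that of
     the smaller point, and the weights t^r and (1 - t)^r are at least 1. *)
  have ge1 z : 0 < z -> z <= 1 -> 1 <= z `^ r.
    by move=> z0 z1; rewrite -[leLHS](powRr0 z); apply: ger_powR; rewrite ?z0.
  have h1 : e `^ p <= t `^ r * e `^ p.
    by apply: ler_peMl; [exact: ltW|apply: ge1 => //; lra].
  have h2 : o `^ p <= (1 - t) `^ r * o `^ p.
    by apply: ler_peMl; [exact: ltW|apply: ge1 => //; lra].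
  have [eo|oe] := leP e o.
    have h : e <= t * e + (1 - t) * o.
      have : 0 <= (1 - t) * (o - e) by apply: mulr_ge0; lra.
      lra.
    have := le0_ger_powR p0 e0 h; lra.
  have h : o <= t * e + (1 - t) * o.
    have : 0 <= t * (e - o) by apply: mulr_ge0; lra.
    lra.
  have := le0_ger_powR p0 o0 h; lra.
have le_r z : 0 < z -> z <= 1 -> z `^ p <= z `^ r.
  by move=> z0 z1; apply: ger_powR; rewrite ?z0.
(* Subadditivity of z^p comes from this factorisation: z^(p-1) is nonincreasing, so it grows when
   the sum is replaced by one summand. *)
have key z : 0 < z -> z `^ p = z * z `^ (p - 1).
  move=> z0; rewrite powRB; last by rewrite (gt_eqF z0) implybT.
  by rewrite powRr1 ?(ltW z0)// mulrCA divff ?(gt_eqF z0)// mulr1.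
have p10 : p - 1 <= 0 by lra.
apply: (@le_trans _ _ (t `^ p * e `^ p + (1 - t) `^ p * o `^ p)); last first.
  by apply: lerD; apply: ler_wpM2r; rewrite ?(ltW ep) ?(ltW op)//; apply: le_r; lra.
rewrite -(powRM _ (ltW t0) (ltW e0)) -(powRM _ (ltW t'0) (ltW o0)).
rewrite (key (t * e))// (key ((1 - t) * o))// key ?addr_gt0// mulrDl.
by apply: lerD; apply: ler_wpM2l; rewrite ?(ltW te0) ?(ltW to0)//;
  apply: le0_ger_powR => //; lra.
Qed.

(** * Signs of the two coefficients *)

(** The increment bound for the zero function: a nonnegative majorant has a nonnegative weighted
    integral. *)
Lemma increment_bound_ge0 (R : realType) (s l al E O : R) :
  0 < s -> 0 <= l -> l <= 1 ->
  (forall u : R, u \in `]0, 1[ ->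
    0 <= al + E * (1 + u) `^ (s - 1) + O * (1 - u) `^ (s - 1)) ->
  0 <= al * (1 / 2 - l + l ^+ 2)
    + (far_coef s l * E + near_coef s l * O) / (s * (s + 1)).
Proof.
move=> s0 l0 l1 h; apply: (le_trans (normr_ge0 (cst 0 (1 : R) - cst 0 (0 : R)))).
apply: (norm_increment_le (f := cst (0 : R))) => //.
- by move=> u _; rewrite mulr0; exact: is_derive_cst.
- by move=> u; exact: cvg_cst.
- by move=> u u01; rewrite normr0 h.
Qed.

Lemma near_coef_ge0 (R : realType) (s l : R) :
  0 < s -> 0 <= l -> l <= 1 -> 0 <= near_coef s l.
Proof.
move=> s0 l0 l1.
have ss : 0 < s * (s + 1) by rewrite mulr_gt0//; lra.
have := @increment_bound_ge0 R s l 0 0 1 s0 l0 l1.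
rewrite mul0r add0r mulr0 mulr1 add0r pmulr_lge0 ?invr_gt0//; apply => u _.
by rewrite mul0r !add0r mul1r powR_ge0.
Qed.

(** For 0 < u < 1 and s > 0, (1 + u)^(s-1) >= 1 / (1 + u) >= 1/2, so the integral is at least half
    of 1/2 - l + l^2, which is positive. Strictness later makes the tangent point [M] positive. *)
Lemma far_coef_gt0 (R : realType) (s l : R) :
  0 < s -> 0 <= l -> l <= 1 -> 0 < far_coef s l.
Proof.
move=> s0 l0 l1.
have ss : 0 < s * (s + 1) by rewrite mulr_gt0//; lra.
have : 0 <= - (1 / 2) * (1 / 2 - l + l ^+ 2)
    + (far_coef s l * 1 + near_coef s l * 0) / (s * (s + 1)).
  apply: increment_bound_ge0 => // u; rewrite in_itv/= => /andP[u0 u1].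
  have h : (1 + u) `^ (-1) <= (1 + u) `^ (s - 1) by apply: ler_powR; lra.
  rewrite powR_inv1 in h; last lra.
  have : 2^-1 <= (1 + u)^-1 by rewrite lef_pV2 ?posrE; lra.
  lra.
rewrite mulr1 mulr0 addr0 => h.
suff : 0 < far_coef s l / (s * (s + 1)) by rewrite pmulr_lgt0 ?invr_gt0.
by have := sqr_ge0 (l - 1 / 2); lra.
Qed.

(** * The linearised Holder bound on one half interval *)

Lemma half_interval_bound (R : realType) (e o q s l : R) :
  0 < e -> 0 < o -> e != o -> 1 <= q -> 0 < s ->
  (s - 1) * q <= 1 -> 0 <= l -> l <= 1 ->
  `|powR_moment ((e - o) / 2) ((e + o) / 2) s (1 - l) 1
    - powR_moment ((e - o) / 2) ((e + o) / 2) s (1 - l) 0|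
  <= (2 `^ ((s - 1) / q))^-1 * (1 / (s * (s + 1))) `^ (1 / q)
     * (1 / 2 - l + l ^+ 2) `^ (1 - 1 / q)
     * (far_coef s l * e `^ ((s - 1) * q)
        + near_coef s l * o `^ ((s - 1) * q)) `^ (1 / q).
Proof.
move=> e0 o0 eo q1 s0; set p := (s - 1) * q => p1 l0 l1.
set k := (e - o) / 2; set d := (e + o) / 2; set W := 1 / 2 - l + l ^+ 2.
have q0 : 0 < q by lra.
have s10 : 0 < s + 1 by lra.
have W0 : 0 < W.
  have -> : W = (l - 1 / 2) ^+ 2 + 1 / 4 by rewrite /W; field.
  by have := sqr_ge0 (l - 1 / 2); lra.
have k0 : k != 0 by rewrite mulf_neq0 ?invr_eq0 ?pnatr_eq0// subr_eq0.
have ep := powR_gt0 p e0; have op := powR_gt0 p o0.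
pose z : R := 2^-1 `^ (s - 1).
have z0 : 0 < z by apply: powR_gt0; lra.
have halfM u : 0 < u -> z * u `^ (s - 1) = (u / 2) `^ (s - 1).
  by move=> u0; rewrite /z -powRM 1?mulrC//; lra.
have xE u : k * u + d = ((1 + u) / 2) * e + (1 - (1 + u) / 2) * o.
  by rewrite /k /d; field.
have x0 u : u \in `]0, 1[ -> 0 < k * u + d.
  rewrite in_itv/= => /andP[u0 u1]; rewrite xE addr_gt0// mulr_gt0//; lra.
have ley u : u \in `]0, 1[ -> (k * u + d) `^ p <=
    z * e `^ p * (1 + u) `^ (s - 1) + z * o `^ p * (1 - u) `^ (s - 1).
  rewrite in_itv/= => /andP[u0 u1]; rewrite xE.
  rewrite (mulrAC z (e `^ p)) (mulrAC z (o `^ p)) !halfM; [|lra|lra].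
  have -> : (1 - u) / 2 = 1 - (1 + u) / 2 by field.
  apply: powR_convex_comb_le => //; [lra|lra|].
  have [s1|s1] := leP s 1; [left|right].
    by split; [lra|rewrite mulr_le0_ge0//; lra].
  (* This is s - 1 <= p, which the subadditive case requires. *)
  have h : 0 <= (s - 1) * (q - 1) by apply: mulr_ge0; lra.
  by rewrite /p in p1 *; split; [lra|apply/andP; split => //; apply: mulr_ge0; lra].
pose C := (far_coef s l * (z * e `^ p) + near_coef s l * (z * o `^ p))
  / (s * (s + 1)).
set D := far_coef s l * e `^ p + near_coef s l * o `^ p.
have CE : C = z * (1 / (s * (s + 1))) * D.
  by rewrite /C /D; field; rewrite !gt_eqF.
have f0 : 0 < 1 / (s * (s + 1)) by rewrite divr_gt0// mulr_gt0.
have D0 : 0 < D.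
  rewrite ltr_wpDr ?mulr_gt0 ?far_coef_gt0//.
  by rewrite mulr_ge0 ?near_coef_ge0 ?(ltW op).
have C0 : 0 < C by rewrite CE mulr_gt0// mulr_gt0.
(* [M] is the mean of y for the weight |u - c|, the tangent point at which the linear bound
   integrates to exactly [A * W]. *)
pose M := C / W; pose A := M `^ (1 / q).
have M0 : 0 < M by exact: divr_gt0.
have A0 : 0 < A by exact: powR_gt0.
apply: (@le_trans _ _ (A * W)).
  (* Splits [A * W] into the constant part and the y part of the tangent line, using C / M = W, to
     match [al], [E] and [O] of [norm_increment_le]. *)
  have -> : A * W = (1 - 1 / q) * A * W
      + (far_coef s l * (A / M / q * (z * e `^ p))
         + near_coef s l * (A / M / q * (z * o `^ p))) / (s * (s + 1)).
    have -> : far_coef s l * (A / M / q * (z * e `^ p))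
         + near_coef s l * (A / M / q * (z * o `^ p))
      = A / M / q * (C * (s * (s + 1))).
      by rewrite /C; field; rewrite !gt_eqF.
    by rewrite /M; field; rewrite !gt_eqF.
  apply: (norm_increment_le (f := fun u => (k * u + d) `^ (s - 1)) s0 l0 l1).
  - by move=> u /x0; exact: is_derive_powR_moment.
  - by apply: continuous_powR_moment => //; rewrite /k /d; lra.
  - move=> u u01; rewrite ger0_norm ?powR_ge0//.
    have -> : s - 1 = p * (1 / q) by rewrite /p; field; rewrite gt_eqF.
    rewrite (powRrM _ p).
    have px := powR_gt0 p (x0 u u01).
    have := powR_young q1 (ltW px) M0; rewrite -/A => h; apply: (le_trans h).
    have -> : p * (1 / q) = s - 1 by rewrite /p; field; rewrite gt_eqF.
    have g0 : 0 <= A / M / q := divr_ge0 (divr_ge0 (ltW A0) (ltW M0)) (ltW q0).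
    have := ler_wpM2l g0 (ley u u01).
    rewrite mulrDr !mulrA; lra.
have -> : (2 `^ ((s - 1) / q))^-1 = z `^ (1 / q).
  rewrite /z -powRrM -powRN -(powR_inv1 (ler0n R 2)) -powRrM; congr (_ `^ _).
  by field; rewrite gt_eqF.
rewrite powRB; last by rewrite (gt_eqF W0) implybT.
rewrite powRr1 ?(ltW W0)//.
have iW0 : 0 <= W^-1 by rewrite invr_ge0 ltW.
have zf0 : 0 < z * (1 / (s * (s + 1))) by exact: mulr_gt0.
rewrite /A /M CE (powRM _ (mulr_ge0 (ltW zf0) (ltW D0)) iW0).
rewrite (powRM _ (ltW zf0) (ltW D0)) (powRM _ (ltW z0) (ltW f0)).
rewrite -(powR_inv1 (ltW W0)) -powRrM mulN1r powRN.
rewrite le_eqVlt; apply/orP; left; apply/eqP.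
by ring.
Qed.

(** * The mean difference as moments, and the conclusion *)

(** Both halves start at the midpoint with slopes of opposite sign, so the midpoint powers of
    exponent [s + 1] cancel, those of exponent [s] add up, and the end values give the other two
    means. *)
Lemma mean_difference_moment (R : realType) (a b s l : R) :
  0 < a -> a < b -> 0 < s ->
  l * arith_mean (a `^ s) (b `^ s) + (1 - l) * (arith_mean a b) `^ s
    - (gen_log_mean s a b) `^ s
  = (b - a) * s / 4 *
    ((powR_moment ((b - a) / 2) ((b + a) / 2) s (1 - l) 1
      - powR_moment ((b - a) / 2) ((b + a) / 2) s (1 - l) 0)
    - (powR_moment ((a - b) / 2) ((a + b) / 2) s (1 - l) 1
      - powR_moment ((a - b) / 2) ((a + b) / 2) s (1 - l) 0)).
Proof.
move=> a0 ab s0.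
have ba : 0 < b - a by rewrite subr_gt0.
have b0 : 0 < b by lra.
have s10 : 0 < s + 1 by lra.
have sN1 : (s == -1) = false by apply: gt_eqF; lra.
(* Nonnegativity lets the outer power [s] undo the root 1/s in the logarithmic mean. *)
have X0 : 0 <= (b `^ (s + 1) - a `^ (s + 1)) / ((s + 1) * (b - a)).
  rewrite divr_ge0 ?mulr_ge0 ?(ltW s10) ?(ltW ba)// subr_ge0.
  by apply: ge0_ler_powR; rewrite ?nnegrE ?(ltW s10) ?(ltW a0) ?(ltW b0) ?(ltW ab).
rewrite /gen_log_mean (lt_eqF ab) (gt_eqF s0) sN1 -powRrM.
rewrite div1r mulVf ?gt_eqF// powRr1// /arith_mean /powR_moment.
have -> : (b - a) / 2 * 1 + (b + a) / 2 = b by field.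
have -> : (a - b) / 2 * 1 + (a + b) / 2 = a by field.
rewrite !mulr0 !add0r (addrC b a) -(opprB b a).
field; rewrite !gt_eqF//=.
Qed.

Theorem theorem4p1 (R : realType) (a b q s lambda : R)
    (ha : 0 < a) (hab : a < b) (hq : 1 <= q) (hs0 : 0 < s) (hs2 : s <= 2)
    (hsq_lower : -1 < (s - 1) * q) (hsq_upper : (s - 1) * q <= 1)
    (hlambda0 : 0 <= lambda) (hlambda1 : lambda <= 1) :
  `| lambda * arith_mean (a `^ s) (b `^ s)
     + (1 - lambda) * (arith_mean a b) `^ s
     - (gen_log_mean s a b) `^ s |
  <= (b - a) * s / 2 `^ ((s - 1) / q + 2)
     * (1 / (s * (s + 1))) `^ (1 / q)
     * (1 / 2 - lambda + lambda ^+ 2) `^ (1 - 1 / q)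
     * (((2 * (2 - lambda) `^ (s + 1) + 2 `^ s * ((s + 1) * lambda - 2)
          + (s + 1) * lambda - s - 2) * a `^ ((s - 1) * q)
         + (2 * lambda `^ (s + 1) + s - (s + 1) * lambda)
           * b `^ ((s - 1) * q)) `^ (1 / q)
        + ((2 * lambda `^ (s + 1) + s - (s + 1) * lambda)
           * a `^ ((s - 1) * q)
           + (2 * (2 - lambda) `^ (s + 1) + 2 `^ s * ((s + 1) * lambda - 2)
              + (s + 1) * lambda - s - 2) * b `^ ((s - 1) * q)) `^ (1 / q))
  /\
  (q = 1 ->
   `| lambda * arith_mean (a `^ s) (b `^ s)
      + (1 - lambda) * (arith_mean a b) `^ s
      - (gen_log_mean s a b) `^ s |
   <= (b - a) * s / (2 `^ (s - 1) * s * (s + 1))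
      * ((2 - lambda) `^ (s + 1) + lambda `^ (s + 1)
         + ((s + 1) * lambda - 2) * 2 `^ (s - 1) - 1)
      * arith_mean (a `^ (s - 1)) (b `^ (s - 1))).
Proof.
have hb : 0 < b by lra.
have ba := hab; rewrite -subr_gt0 in ba.
have s10 : 0 < s + 1 by lra.
have nab : a != b by rewrite lt_eqF.
have nba : b != a by rewrite gt_eqF.
have Ia := half_interval_bound ha hb nab hq hs0 hsq_upper hlambda0 hlambda1.
have Ib := half_interval_bound hb ha nba hq hs0 hsq_upper hlambda0 hlambda1.
have main : `| lambda * arith_mean (a `^ s) (b `^ s)
     + (1 - lambda) * (arith_mean a b) `^ s - (gen_log_mean s a b) `^ s |
  <= (b - a) * s / 2 `^ ((s - 1) / q + 2)
     * (1 / (s * (s + 1))) `^ (1 / q)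
     * (1 / 2 - lambda + lambda ^+ 2) `^ (1 - 1 / q)
     * ((far_coef s lambda * a `^ ((s - 1) * q)
         + near_coef s lambda * b `^ ((s - 1) * q)) `^ (1 / q)
        + (near_coef s lambda * a `^ ((s - 1) * q)
         + far_coef s lambda * b `^ ((s - 1) * q)) `^ (1 / q)).
  rewrite mean_difference_moment// normrM.
  have w0 : 0 < 2 `^ ((s - 1) / q) :> R by exact: powR_gt0.
  have h4 : 0 < (b - a) * s / 4 by rewrite divr_gt0// mulr_gt0.
  rewrite (gtr0_norm h4).
  apply: (le_trans (ler_wpM2l (ltW h4) (le_trans (ler_normB _ _) (lerD Ib Ia)))).
  (* The 4 in the prefactor is the 2^2 of the stated denominator; the remaining powers are then
     generalised so that [field] treats them as atoms. *)
  rewrite (@powRD _ 2 ((s - 1) / q) 2); last by rewrite pnatr_eq0 implybT.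
  rewrite powR_mulrn// (addrC (near_coef s lambda * _)) invfM.
  rewrite le_eqVlt; apply/orP; left; apply/eqP.
  move: w0; move: (2 `^ ((s - 1) / q)) ((1 / (s * (s + 1))) `^ (1 / q))
    (_ `^ (1 - 1 / q)) ((far_coef _ _ * _ + _) `^ _)
    ((far_coef _ _ * _ + _) `^ _) => T X Y P Q T0.
  by field; exact: lt0r_neq0.
split; first exact: main.
(* At q = 1 the factor with exponent 1 - 1/q becomes 1 and the two brackets sum to (far +
   near)(a^(s-1) + b^(s-1)), so both bounds coincide. *)
move=> q1; apply: (le_trans main); rewrite q1 !divr1 subrr powRr0 !mulr1.
have fge0 := ltW (far_coef_gt0 hs0 hlambda0 hlambda1).
have nge0 := near_coef_ge0 hs0 hlambda0 hlambda1.
have f1 : 0 <= 1 / (s * (s + 1)) by rewrite divr_ge0// mulr_ge0// ltW.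
have as0 := powR_ge0 a (s - 1); have bs0 := powR_ge0 b (s - 1).
rewrite (powRr1 f1) (powRr1 (addr_ge0 (mulr_ge0 fge0 as0) (mulr_ge0 nge0 bs0))).
rewrite (powRr1 (addr_ge0 (mulr_ge0 nge0 as0) (mulr_ge0 fge0 bs0))).
rewrite /far_coef /near_coef /arith_mean.
have n20 : 2 != 0 :> R by rewrite pnatr_eq0.
have -> : 2 `^ (s - 1 + 2) = 4 * 2 `^ (s - 1) :> R.
  by rewrite powRD ?n20 ?implybT// powR_mulrn//; ring.
have -> : 2 `^ s = 2 * 2 `^ (s - 1) :> R by rewrite mulr_powRB1.
rewrite le_eqVlt; apply/orP; left; apply/eqP.
by field; rewrite (gt_eqF hs0) (gt_eqF s10) gt_eqF ?powR_gt0.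
Qed.
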